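(* Let $\mathfrak{A}$ be a unital $C^*$-algebra, $a\in\mathfrak{A}$ a nonzero positive element, and let $x\in\mathfrak{A}_a$. Then $$\frac14\left\|xx^{\sharp_a}+x^{\sharp_a}x\right\|_a\le v_a^2(x)\le\frac12\left\|xx^{\sharp_a}+x^{\sharp_a}x\right\|_a.$$
   Context: $\mathcal{S}(\mathfrak{A})$ is the set of states of $\mathfrak{A}$ and $\mathcal{S}_a(\mathfrak{A})=\{f/f(a): f\in\mathcal{S}(\mathfrak{A}),\ f(a)\ne 0\}$. For $x\in\mathfrak{A}$, $\|x\|_a=\sup\{\sqrt{f(x^*ax)}: f\in\mathcal{S}_a(\mathfrak{A})\}\in[0,\infty]$, and the $a$-numerical radius is $v_a(x)=\sup\{|f(ax)|: f\in\mathcal{S}_a(\mathfrak{A})\}$; $v_a^2(x)$ means $(v_a(x))^2$. An element $x^{\sharp_a}\in\mathfrak{A}$ is an $a$-adjoint of $x$ if $ax^{\sharp_a}=x^*a$; $\mathfrak{A}_a$ is the set of all elements of $\mathfrak{A}$ admitting an $a$-adjoint (a subalgebra of $\mathfrak{A}$ on which $\|\cdot\|_a$ is a finite semi-norm). $a$-adjoints need not be unique; $x^{\sharp_a}$ denotes an $a$-adjoint of $x$, and the quantities in the claim do not depend on the choice. *)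

(* Defs.v *)
From HB Require Import structures.
From mathcomp Require Import all_boot all_order all_algebra.
From mathcomp Require Import complex.
From mathcomp Require Import all_classical all_reals all_analysis.

Set Implicit Arguments.
Unset Strict Implicit.
Unset Printing Implicit Defensive.

Import Order.TTheory GRing.Theory Num.Theory.
Import numFieldNormedType.Exports.

Local Open Scope classical_set_scope.
Local Open Scope ring_scope.
Local Open Scope complex_scope.

(* Complex unital C*-algebras.  The norm and its completeness are fields of the
   mixin because Hierarchy-Builder has no common substructure of rings and
   normed Z-modules below numDomainType, so algType and completeNormedModType
   cannot be joined.  An algType satisfies 1 != 0. *)
HB.mixin Record isCStarAlgebra (R : realType) A of GRing.Algebra R[i] A := {
  star : A -> A ;
  cnorm : A -> R ;
  starD : forall x y : A, star (x + y) = star x + star y ;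
  starZ : forall (k : R[i]) (x : A), star (k *: x) = k^* *: star x ;
  starM : forall x y : A, star (x * y) = star y * star x ;
  starK : forall x : A, star (star x) = x ;
  cnorm_eq0 : forall x : A, cnorm x = 0 -> x = 0 ;
  cnormD : forall x y : A, cnorm (x + y) <= cnorm x + cnorm y ;
  cnormZ : forall (k : R[i]) (x : A), cnorm (k *: x) = Normc.normc k * cnorm x ;
  cnormM : forall x y : A, cnorm (x * y) <= cnorm x * cnorm y ;
  cnorm_complete : forall u : nat -> A,
    (forall e : R, 0 < e -> exists N : nat, forall m n : nat,
       (N <= m)%N -> (N <= n)%N -> cnorm (u m - u n) < e) ->
    exists l : A, (fun n => cnorm (u n - l)) @ \oo --> (0 : R) ;
  cnorm_cstar : forall x : A, cnorm (star x * x) = cnorm x ^+ 2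
}.

#[short(type="cstarAlgType")]
HB.structure Definition CStarAlgebra (R : realType) :=
  {A of isCStarAlgebra R A & GRing.Algebra R[i] A}.

Definition cstar_positive (R : realType) (A : cstarAlgType R) (a : A) : Prop :=
  exists b : A, a = star b * b.

(* In R[i], 0 <= z says that z is real and nonnegative. *)
Definition is_state (R : realType) (A : cstarAlgType R)
    (f : {scalar A}) : Prop :=
  [/\ exists M : R, forall x : A, Normc.normc (f x) <= M * cnorm x,
      forall x : A, 0 <= f (star x * x)
    & f 1 = 1].

Definition states_at (R : realType) (A : cstarAlgType R) (a : A) :
    set (A -> R[i]) :=
  [set g | exists f : {scalar A},
     [/\ is_state f, f a != 0 & g = fun y => f y / f a]].

(* Supremum in the ordered set [0, +oo], whose least element is 0: for
   a set S of nonnegative values it differs from ereal_sup only if S is empty,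
   where ereal_sup is -oo. *)
Definition nng_sup (R : realType) (S : set \bar R) : \bar R :=
  maxe 0%E (ereal_sup S).

(* For g in states_at a and a positive, g (star x * a * x) is real and
   nonnegative, so that taking its real part loses nothing. *)
Definition anorm (R : realType) (A : cstarAlgType R) (a x : A) : \bar R :=
  nng_sup [set (Num.sqrt (complex.Re (g (star x * a * x))))%:E
          | g in states_at a].

Definition anum_radius (R : realType) (A : cstarAlgType R) (a x : A) : \bar R :=
  nng_sup [set (Normc.normc (g (a * x)))%:E | g in states_at a].

Definition is_a_adjoint (R : realType) (A : cstarAlgType R) (a x y : A) : Prop :=
  a * y = star x * a.

Definition a_adjointable (R : realType) (A : cstarAlgType R) (a : A) : set A :=
  [set x | exists y : A, is_a_adjoint a x y].

(* Main.v *)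
Require Import Defs.
From HB Require Import structures.
From mathcomp Require Import all_boot all_order all_algebra.
From mathcomp Require Import complex.
From mathcomp Require Import all_classical all_reals all_analysis.
From mathcomp Require Import ring lra.
Import Order.TTheory GRing.Theory Num.Theory.
Import numFieldNormedType.Exports.
Local Open Scope classical_set_scope.
Local Open Scope ring_scope.

(* For a state f, <y, z> = f (z^* a y) is a positive semidefinite sesquilinear
   form on the algebra, for which left multiplications by x and xs are adjoint
   to each other.  Put S = x xs + xs x.

   Upper bound: by Cauchy-Schwarz, |<x1, 1>|^2 is at most <1, 1> times each of
   <x1, x1> and <xs1, xs1>; these two add up to <S1, 1>, which is at most
   |S1| |1|.

   Lower bound: each vector y with <y, y> <> 0 yields another state at a, so
   v = v_a(x) gives |<xy, y>| <= v <y, y> for all y.  By polarization, an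
   a-selfadjoint T with |<Ty, y>| <= c <y, y> for all y satisfies |Ty| <= c |y|.
   Apply this to x + xs and to i(x - xs), with c = 2v; the parallelogram law
   turns the two resulting bounds into <Sy, y> = |xy|^2 + |xs y|^2
   <= 4 v^2 <y, y>.  Then apply it once more, to S itself. *)

(** * Involution and norm *)

Section Star.
Context {R : realType} {A : cstarAlgType R}.
Implicit Types (x y : A).

Lemma starN x : star (- x) = - star x.
Proof. by rewrite -scaleN1r starZ rmorphN1 scaleN1r. Qed.

Lemma star1 : star 1 = 1 :> A.
Proof. by rewrite -[LHS]mulr1 -{2}(starK 1) -starM mulr1 starK. Qed.

Lemma positive_selfadj {a : A} : cstar_positive a -> star a = a.
Proof. by move=> [b ->]; rewrite starM starK. Qed.

(** Triangle inequality for x and -x, whose norms agree and whose sum is 0. *)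
Lemma cnorm_ge0 x : 0 <= cnorm x.
Proof.
have cnorm0 : cnorm (0 : A) = 0.
  by rewrite -(scale0r 0) cnormZ Normc.normc0 mul0r.
have cnormN : cnorm (- x) = cnorm x.
  by rewrite -scaleN1r cnormZ normcN Normc.normc1 mul1r.
by have := cnormD x (- x); rewrite subrr cnorm0 cnormN; lra.
Qed.

End Star.

Lemma normc_ge0 {R : realType} (z : R[i]) : 0 <= Normc.normc z.
Proof. by case: z => p q; exact: sqrtr_ge0. Qed.

(** * The real part of the sesquilinear form of a functional *)

Section ReForm.
Context {R : realType} {A : cstarAlgType R}.
Implicit Types (f : {scalar A}) (a x y z : A).

(** Taking real parts keeps all estimates in the ordered field R; bounds on complex moduli are
    recovered by rotating phases. *)
Definition re_form f a y z : R := complex.Re (f (star z * a * y)).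

Lemma re_formDl f a x y z : re_form f a (x + y) z = re_form f a x z + re_form f a y z.
Proof. by rewrite /re_form mulrDr linearD raddfD. Qed.

Lemma re_formDr f a x y z : re_form f a x (y + z) = re_form f a x y + re_form f a x z.
Proof. by rewrite /re_form starD !mulrDl linearD raddfD. Qed.

Lemma re_formNl f a x y : re_form f a (- x) y = - re_form f a x y.
Proof. by rewrite /re_form mulrN linearN raddfN. Qed.

Lemma re_formNr f a x y : re_form f a x (- y) = - re_form f a x y.
Proof. by rewrite /re_form starN !mulNr linearN raddfN. Qed.

Lemma re_formZl f a (t : R) x y :
  re_form f a (t%:C%C *: x) y = t * re_form f a x y.
Proof.
rewrite /re_form -scalerAr linearZ /=; case: (f _) => p q /=.
by rewrite mul0r subr0.
Qed.

Lemma re_formZ f a (k : R[i]) x :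
  re_form f a (k *: x) (k *: x) = Normc.normc k ^+ 2 * re_form f a x x.
Proof.
have -> : Normc.normc k ^+ 2 = complex.Re k ^+ 2 + complex.Im k ^+ 2.
  by case: k => c d /=; rewrite sqr_sqrtr ?addr_ge0 ?sqr_ge0.
rewrite /re_form.
have -> : star (k *: x) * a * (k *: x) = (k^*%C * k) *: (star x * a * x).
  by rewrite starZ -!scalerAl -scalerAr scalerA.
rewrite linearZ_LR /=.
case: (f _) => p q; case: k => c d /=.
by ring.
Qed.

(** * Cauchy-Schwarz and operator bounds for a positive semidefinite form *)

Section Positive.
Variables (f : {scalar A}) (a : A).
Hypothesis f_ge0 : forall y, 0 <= f (star y * a * y).
Local Notation B := (re_form f a).

Lemma re_form_ge0 y : 0 <= B y y.
Proof. by have := f_ge0 y; rewrite /re_form; case: (f _) => p q /andP[]. Qed.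

Lemma form_diag y : f (star y * a * y) = (B y y)%:C%C.
Proof.
by have := f_ge0 y; rewrite /re_form; case: (f _) => p q /andP[/eqP/= ->].
Qed.

(** Positivity makes the form real at y + iz; the vanishing of its imaginary part is the
    symmetry. *)
Lemma re_formC y z : B y z = B z y.
Proof.
have := form_diag (y + 'i%C *: z).
rewrite starD starZ !(mulrDl, mulrDr) -!scalerAl -!scalerAr !linearD !linearZ /=.
rewrite !form_diag => /(congr1 (@complex.Im R)); rewrite /re_form.
case: (f (star y * a * z)) => p q; case: (f (star z * a * y)) => r s /=.
lra.
Qed.

(** The value of the form at y + tz is a quadratic in t that is never negative. *)
Lemma re_form_CauchySchwarz y z : B y z ^+ 2 <= B y y * B z z.
Proof.
have H (t : R) : 0 <= B y y + 2 * t * B y z + t ^+ 2 * B z z.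
  have := re_form_ge0 (y + t%:C%C *: z).
  rewrite re_formDl !re_formDr !re_formZl (re_formC y (_ *: _)) (re_formC z (_ *: _)).
  rewrite !re_formZl (re_formC z y).
  by congr (_ <= _); ring.
have z0 := re_form_ge0 z; have y0 := re_form_ge0 y.
have [z_eq0|z_neq0] := eqVneq (B z z) 0.
  have [->|yz0] := eqVneq (B y z) 0; first by rewrite expr0n/= mulr_ge0.
  (* When [B z z] is 0 the quadratic is affine in t, and this t gives it the value -1. *)
  have := H (- (B y y + 1) / (2 * B y z)).
  rewrite z_eq0 mulr0 addr0.
  have -> : 2 * (- (B y y + 1) / (2 * B y z)) * B y z = - (B y y + 1) by field.
  lra.
have zp : 0 < B z z by rewrite lt_def z_neq0.
(* The minimizer of the quadratic. *)
have := H (- B y z / B z z).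
have -> : B y y + 2 * (- B y z / B z z) * B y z + (- B y z / B z z) ^+ 2 * B z z
  = (B y y * B z z - B y z ^+ 2) / B z z by field.
by rewrite pmulr_lge0 ?invr_gt0// subr_ge0.
Qed.

Lemma form_CauchySchwarz y z :
  Normc.normc (f (star z * a * y)) ^+ 2 <= B y y * B z z.
Proof.
set w := f _; set n := Normc.normc w.
have [->|n0] := eqVneq n 0.
  by rewrite expr0n/= mulr_ge0 ?re_form_ge0.
(* Scaling y by the conjugate of w makes the pairing real, so that the real inequality controls the
   full modulus. *)
have Bw : B (w^*%C *: y) z = n ^+ 2.
  rewrite /re_form -scalerAr linearZ /= -/w /n; case: (w) => p q /=.
  by rewrite sqr_sqrtr ?addr_ge0 ?sqr_ge0//; ring.
have nw : Normc.normc w^*%C = n by rewrite /n; case: (w) => p q /=; rewrite sqrrN.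
have := re_form_CauchySchwarz (w^*%C *: y) z.
rewrite Bw re_formZ nw (expr2 (n ^+ 2)) -(mulrA _ (B y y)) ler_pM2l//.
by rewrite exprn_even_gt0.
Qed.

(** Polarization: T is symmetric for [B], so subtracting the hypotheses at y + tTy and y - tTy
    isolates [B (T * y) (T * y)]; then t is optimized. *)
Lemma selfadjoint_bound (T : A) (v : R) : 0 <= v -> a * T = star T * a ->
  (forall y, `|B (T * y) y| <= v * B y y) ->
  forall y, B (T * y) (T * y) <= v ^+ 2 * B y y.
Proof.
move=> v0 aT bT y.
have T_sym u w : B (T * u) w = B u (T * w).
  by rewrite /re_form starM -!mulrA (mulrA a) aT !mulrA.
have H (t : R) : 2 * t * B (T * y) (T * y) <=
                 v * (B y y + t ^+ 2 * B (T * y) (T * y)).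
  set z := t%:C%C *: (T * y).
  have zE : B (T * y) z = t * B (T * y) (T * y) by rewrite re_formC re_formZl.
  have zz : B z z = t ^+ 2 * B (T * y) (T * y).
    by rewrite /z re_formZl re_formC re_formZl mulrA.
  have := bT (y + z); have := bT (y - z); rewrite !ler_norml.
  rewrite !mulrDr !mulrN !(re_formDl, re_formDr, re_formNl, re_formNr).
  rewrite (re_formC (T * z)) -T_sym (re_formC z y) zE zz.
  rewrite !mulrDr !mulrN => /andP[h1 h2] /andP[h3 h4].
  lra.
have [v_eq0|v_neq0] := eqVneq v 0.
  by have := H 1; rewrite v_eq0 expr0n/= !mul0r; lra.
have vp : 0 < v by rewrite lt_def v_neq0.
(* The optimal t is 1/v; for v = 0, any positive t does. *)
have := H v^-1.
rewrite -(ler_pM2l vp).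
have -> : v * (2 * v^-1 * B (T * y) (T * y)) = 2 * B (T * y) (T * y) by field.
have -> : v * (v * (B y y + v^-1 ^+ 2 * B (T * y) (T * y))) =
  v ^+ 2 * B y y + B (T * y) (T * y) by field.
lra.
Qed.

Hypothesis a_sa : star a = a.

Lemma adjoint_sym {x xs} : is_a_adjoint a x xs -> star xs * a = a * x.
Proof. by move=> /(congr1 star); rewrite !starM starK a_sa. Qed.

(** The element x + xs is a-selfadjoint, and x and xs have the same real quadratic form, whence the
    factor 2. *)
Lemma real_part_bound {x xs} (v : R) : 0 <= v -> is_a_adjoint a x xs ->
  (forall y, `|B (x * y) y| <= v * B y y) ->
  forall y, B ((x + xs) * y) ((x + xs) * y) <= (2 * v) ^+ 2 * B y y.
Proof.
move=> v0 adj bx; apply: selfadjoint_bound; first by rewrite mulr_ge0.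
  by rewrite mulrDr starD mulrDl (adjoint_sym adj) adj addrC.
move=> y; rewrite mulrDl re_formDl.
have -> : B (xs * y) y = B (x * y) y.
  by rewrite re_formC /re_form starM -!mulrA (mulrA _ a y) (adjoint_sym adj) !mulrA.
have := bx y; rewrite -mulr2n normrMn mulr2n; lra.
Qed.

Lemma anticommutator_diag {x xs} : is_a_adjoint a x xs -> forall y,
  B ((x * xs + xs * x) * y) y = B (x * y) (x * y) + B (xs * y) (xs * y).
Proof.
move=> adj y; rewrite mulrDl re_formDl addrC.
congr (_ + _); rewrite /re_form starM.
  by rewrite -(mulrA _ (star x) a) -adj !mulrA.
by rewrite -(mulrA _ (star xs) a) (adjoint_sym adj) !mulrA.
Qed.

(** Since f(ax) pairs x with 1 and also 1 with xs, Cauchy-Schwarz applies in two ways; the results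
    are added. *)
Lemma functional_bound {x xs} : is_a_adjoint a x xs ->
  2 * Normc.normc (f (a * x)) ^+ 2 <= B 1 1 * B (x * xs + xs * x) 1.
Proof.
move=> adj.
have -> : B (x * xs + xs * x) 1 = B x x + B xs xs.
  by have := anticommutator_diag adj 1; rewrite !mulr1.
have := form_CauchySchwarz x 1; have := form_CauchySchwarz 1 xs.
rewrite mulr1 (adjoint_sym adj) star1 mul1r; lra.
Qed.

Lemma anticommutator_bound {x xs} (v : R) : 0 <= v -> is_a_adjoint a x xs ->
  (forall y, Normc.normc (f (star y * a * (x * y))) <= v * B y y) ->
  forall y, B ((x * xs + xs * x) * y) ((x * xs + xs * x) * y) <=
            (4 * v ^+ 2) ^+ 2 * B y y.
Proof.
move=> v0 adj bx.
have adj' := adjoint_sym adj.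
apply: selfadjoint_bound; first by rewrite mulr_ge0 ?sqr_ge0.
  rewrite mulrDr starD mulrDl !starM; congr (_ + _).
    by rewrite -(mulrA (star xs)) -adj !mulrA adj'.
  by rewrite -(mulrA (star x)) adj' !mulrA -adj.
move=> y.
have normc_Re (w : R[i]) : `|complex.Re w| <= Normc.normc w.
  case: w => p q /=; rewrite -sqrtr_sqr ler_sqrt ?lerDl ?sqr_ge0//.
  by rewrite addr_ge0 ?sqr_ge0.
have := real_part_bound v v0 adj (fun y => le_trans (normc_Re _) (bx y)) y.
have iadj : is_a_adjoint a ('i%C *: x) (- 'i%C *: xs).
  rewrite /is_a_adjoint starZ -scalerAl -scalerAr adj.
  by congr (_ *: _); apply/eqP; rewrite eq_complex /= oppr0 !eqxx.
(* The real part of iw is minus the imaginary part of w, again at most |w|. *)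
have ibx z : `|B ('i%C *: x * z) z| <= v * B z z.
  apply: le_trans (bx z); rewrite -scalerAl /re_form -scalerAr linearZ /=.
  case: (f _) => p q /=; rewrite mul0r mul1r add0r normrN -sqrtr_sqr.
  by rewrite ler_sqrt ?lerDr ?sqr_ge0// addr_ge0 ?sqr_ge0.
have := real_part_bound v v0 iadj ibx y.
have i1 : Normc.normc ('i%C : R[i]) = 1.
  by rewrite /= expr0n expr1n add0r sqrtr1.
(* The second element is i(x - xs), and the unimodular i drops out. By the parallelogram law the two
   bounds sum to 2<Sy, y> <= 8 v^2 <y, y>. *)
rewrite scaleNr -scalerBr -scalerAl re_formZ i1 expr1n mul1r.
rewrite !mulrDl !mulNr !(re_formDl, re_formDr, re_formNl, re_formNr).
rewrite -re_formDl -(mulrDl _ _ y) (anticommutator_diag adj).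
rewrite ger0_norm; last by rewrite addr_ge0 ?re_form_ge0.
lra.
Qed.

End Positive.
End ReForm.

(** * Vector states and the suprema over states *)

Section States.
Context {R : realType} {A : cstarAlgType R}.
Implicit Types (f : {scalar A}) (a x y z : A).

(** The normalized vector state of y in the representation given by f. *)
Definition compression f y z : R[i] := (f (star y * y))^-1 * f (star y * z * y).

Lemma compression_is_scalar f y : scalar (compression f y).
Proof.
move=> k u v; rewrite /compression mulrDr mulrDl -scalerAr -scalerAl.
by rewrite linearD linearZ_LR /= mulrDr mulrCA.
Qed.

HB.instance Definition _ f y :=
  GRing.isLinear.Build R[i] A R[i] *%R (compression f y)
    (compression_is_scalar f y).

Lemma compression_state f y :
  is_state f -> f (star y * y) != 0 -> is_state (compression f y).
Proof.
move=> [[M fM] f_ge0 f1] y0; split.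
(* Using [|M|] supplies the sign needed for monotonicity. *)
- exists (Normc.normc (f (star y * y))^-1 * (`|M| * (cnorm (star y) * cnorm y))) => z.
  rewrite /compression Normc.normcM -(mulrA _ (_ * _)) ler_wpM2l ?normc_ge0//.
  apply: le_trans (fM _) _; rewrite -(mulrA `|M|).
  apply: le_trans (ler_wpM2r (cnorm_ge0 _) (ler_norm M)) _.
  rewrite ler_wpM2l// (mulrAC (cnorm (star y))); apply: le_trans (cnormM _ _) _.
  by rewrite ler_wpM2r ?cnorm_ge0 ?cnormM.
- move=> z; rewrite /compression mulr_ge0 ?invr_ge0//.
  by rewrite -mulrA -(mulrA (star z)) mulrA -starM.
- by rewrite /= /compression mulr1 mulVf.
Qed.

Lemma positive_state_ge0 f a : cstar_positive a -> is_state f ->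
  forall y, 0 <= f (star y * a * y).
Proof.
move=> [b ->] [_ f_ge0 _] y.
by have := f_ge0 (b * y); rewrite starM !mulrA.
Qed.

Lemma nng_sup_ub (S : set \bar R) u : S u -> (u <= nng_sup S)%E.
Proof. by move=> Su; rewrite le_max ereal_sup_ubound ?orbT. Qed.

Lemma nng_sup_le (S : set \bar R) u : (0 <= u)%E ->
  (forall s, S s -> (s <= u)%E) -> (nng_sup S <= u)%E.
Proof. by move=> u0 Su; rewrite ge_max u0; apply: ge_ereal_sup. Qed.

Lemma nng_sup_ge0 (S : set \bar R) : (0 <= nng_sup S)%E.
Proof. by rewrite le_max lexx. Qed.

Lemma normc_div_real (z : R[i]) (t : R) : 0 < t ->
  Normc.normc (z / t%:C%C) = Normc.normc z / t.
Proof.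
move=> t0; rewrite Normc.normcM Normc.normcV /= expr0n addr0 sqrtr_sqr.
by rewrite gtr0_norm.
Qed.

Lemma Re_div_real (z : R[i]) (t : R) :
  complex.Re (z / t%:C%C) = complex.Re z / t.
Proof. by rewrite -fmorphV /=; case: z => p q /=; rewrite mulr0 subr0. Qed.

(** The compression by y, rescaled at a, sends ax to <xy, y>/<y, y>. If <y, y> = 0, Cauchy-Schwarz
    makes the left side vanish. *)
Lemma anum_radius_bound f a x (v : R) : cstar_positive a -> is_state f ->
  (anum_radius a x <= v%:E)%E ->
  forall y, Normc.normc (f (star y * a * (x * y))) <= v * re_form f a y y.
Proof.
move=> a_pos fs xv y.
have fa := positive_state_ge0 f a a_pos fs.
have CS := form_CauchySchwarz f a fa (x * y) y.
have [y0|y0] := eqVneq (re_form f a y y) 0.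
  by move: CS; rewrite y0 !mulr0 exprn_even_le0 //= => /eqP ->.
have yp : 0 < re_form f a y y by rewrite lt_def y0 re_form_ge0.
have faE : f (star y * a * y) = (re_form f a y y)%:C%C by exact: form_diag.
have f1 z : 0 <= f (star z * 1 * z).
  by case: fs => _ fp _; rewrite mulr1.
have yy0 : f (star y * y) != 0.
  apply/eqP => yy.
  (* Cauchy-Schwarz with weight 1: if f(y^* y) were 0, so would be f(y^* a y). *)
  have := form_CauchySchwarz f 1 f1 (a * y) y.
  rewrite mulr1 mulrA faE {3}/re_form mulr1 yy /= mulr0.
  rewrite expr0n addr0 sqrtr_sqr.
  by rewrite exprn_even_le0 //= normr_eq0 (negbTE y0).
have := compression_state f y fs yy0.
set g : {scalar A} := compression f y => gs.
have gE z : g z = (f (star y * y))^-1 * f (star y * z * y) by [].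
have ga : g a != 0.
  rewrite gE mulf_neq0 ?invr_eq0// faE.
  by apply/eqP => -[] /eqP; rewrite (negbTE y0).
have : ((Normc.normc (g (a * x) / g a))%:E <= v%:E)%E.
  apply: le_trans xv; apply: nng_sup_ub.
  by exists (fun z => g z / g a) => //; exists g.
have -> : g (a * x) / g a = f (star y * a * (x * y)) / (re_form f a y y)%:C%C.
  rewrite !gE -mulf_div divff ?invr_eq0// mul1r faE.
  by rewrite !mulrA.
by rewrite normc_div_real// lee_fin ler_pdivrMr.
Qed.

End States.

Theorem corollary3p5 (R : realType) (A : cstarAlgType R) (a : A)
    (ha : cstar_positive a) (a_neq0 : a != 0)
    (x : A) (hx : a_adjointable a x)
    (xs : A) (hxs : is_a_adjoint a x xs) :
  ((4^-1 : R)%:E * anorm a (x * xs + xs * x)%R <= anum_radius a x ^+ 2)%E /\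
  (anum_radius a x ^+ 2 <= (2^-1 : R)%:E * anorm a (x * xs + xs * x)%R)%E.
Proof.
have a_sa := positive_selfadj ha.
set S := x * xs + xs * x.
have BE (f : {scalar A}) y : complex.Re (f (star y * a * y)) = re_form f a y y by [].
have v0 : (0 <= anum_radius a x)%E by exact: nng_sup_ge0.
have n0 : (0 <= anorm a S)%E by exact: nng_sup_ge0.
have f1E (f : {scalar A}) : is_state f -> f a = (re_form f a 1 1)%:C%C.
  move=> fs; rewrite -(form_diag f a); last exact: positive_state_ge0.
  by rewrite star1 mul1r mulr1.
have f1p (f : {scalar A}) : is_state f -> f a != 0 -> 0 < re_form f a 1 1.
  move=> fs; rewrite f1E// => fa0.
  rewrite lt_def re_form_ge0 ?andbT//; last exact: positive_state_ge0.
  by apply: contra_neq fa0 => ->.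
split.
  case E : (anum_radius a x) v0 => [v||] // v0; last by rewrite expeS mulyy leey.
  rewrite -EFin_expe muleC lee_pdivrMr//.
  apply: nng_sup_le => [|_ [_ [f [fs fa0 ->]] <-]].
    by rewrite lee_fin mulr_ge0 ?sqr_ge0.
  rewrite f1E// Re_div_real BE lee_fin.
  (* Lower bound, v finite: y = 1 gives |S|^2 <= (4 v^2)^2 |1|^2. *)
  have := anticommutator_bound f a (positive_state_ge0 f a ha fs) a_sa v v0 hxs
    (anum_radius_bound f a x v ha fs _) 1.
  rewrite E lexx mulr1 -/S => /(_ isT) H.
  rewrite -[leRHS]ger0_norm ?mulr_ge0 ?sqr_ge0// -sqrtr_sqr.
  rewrite ler_sqrt ?sqr_ge0// ler_pdivrMr ?f1p//.
  by rewrite (mulrC _ 4).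
case E : (anorm a S) n0 => [n||] // n0; last first.
  by rewrite mulry gtr0_sg ?invr_gt0// mul1e leey.
have H : (anum_radius a x <= (Num.sqrt (2^-1 * n))%:E)%E.
  apply: nng_sup_le => [|_ [_ [f [fs fa0 ->]] <-]].
    by rewrite lee_fin sqrtr_ge0.
  have fp := f1p f fs fa0; have fa := positive_state_ge0 f a ha fs.
  rewrite f1E// normc_div_real// lee_fin -[leLHS]ger0_norm; last first.
    by rewrite divr_ge0 ?normc_ge0 ?(ltW fp).
  rewrite -sqrtr_sqr ler_sqrt ?mulr_ge0// exprMn exprVn ler_pdivrMr ?exprn_gt0//.
  have := functional_bound f a fa a_sa hxs; rewrite -/S.
  have SS : re_form f a S S <= n ^+ 2 * re_form f a 1 1.
    have : ((Num.sqrt (re_form f a S S / re_form f a 1 1))%:E <= n%:E)%E.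
      rewrite -E; apply: nng_sup_ub.
      exists (fun z => f z / f a); first by exists f.
      by rewrite f1E// Re_div_real BE.
    rewrite lee_fin -(ler_pXn2r (n := 2))// ?nnegrE ?sqrtr_ge0//.
    by rewrite sqr_sqrtr ?ler_pdivrMr// divr_ge0 ?re_form_ge0.
  have S1 : re_form f a S 1 <= n * re_form f a 1 1.
    apply: le_trans (ler_norm _) _.
    rewrite -(ler_pXn2r (n := 2))// ?nnegrE ?mulr_ge0 ?(ltW fp)//.
    rewrite real_normK ?num_real//; apply: le_trans (re_form_CauchySchwarz f a fa S 1) _.
    by rewrite exprMn expr2 (expr2 (re_form _ _ _ _)) !mulrA ler_pM2r// -expr2.
  (* Chains 2|f(ax)|^2 <= <1, 1><S, 1> <= n <1, 1>^2. *)
  move: S1; rewrite -(ler_pM2l fp) => S1 T; lra.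
case: (anum_radius a x) v0 H => [v||] //.
rewrite lee_fin => v0; rewrite lee_fin => H; rewrite -EFin_expe -EFinM lee_fin.
rewrite -(sqr_sqrtr (a := 2^-1 * n)) ?mulr_ge0//.
by rewrite ler_pXn2r// nnegrE ?sqrtr_ge0.
Qed.
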